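(* Let $n\ge 2$, let $l_1,\dots,l_n>0$, and fix a vector $b_1\in\mathbb{R}^3$ with $|b_1|=l_1$. Consider the signed volume function $$V(b_2,\dots,b_n)=[b_1,b_2,b_3]+[b_1,b_2+b_3,b_4]+\cdots+[b_1,b_2+\cdots+b_{n-1},b_n]$$ on the parameter space of $n$-arms, i.e. the product of spheres $\{(b_2,\dots,b_n)\in(\mathbb{R}^3)^{n-1} : |b_r|=l_r,\ r=2,\dots,n\}$. Up to mirror-symmetry, the critical points of $V$ are exactly the configurations of the following form. There exists a division of the $n$-arm into the sub-arm $b_1$, a sub-arm $b_2,\dots,b_k$ and a sub-arm $b_{k+1},\dots,b_n$ such that: (1) $b_1$ is orthogonal to each of $b_2,\dots,b_k$ (so this sub-arm lies in a plane orthogonal to $b_1$); (2) the vertices $B_1,\dots,B_k$ of the sub-arm $b_2,\dots,b_k$ lie on a circle (in the plane through $B_1$ orthogonal to $b_1$), satisfying the closing condition if $n-k$ is odd, and the diameter condition if $n-k$ is even; (3) the sub-arm $b_{k+1},\dots,b_n$ is a zigzag, which projects orthogonally (along $b_1$) to a diameter of that circle.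
   Context: **Arms.** An $n$-arm in $\mathbb{R}^3$ is given by vectors $b_1,\dots,b_n$ of fixed lengths $l_1,\dots,l_n$; its vertices are $O$ (the origin), $B_1,\dots,B_n$, where $B_j$ is the endpoint of $c_j=b_1+\cdots+b_j$. $[u,v,w]$ is the triple product (determinant). The function $V$ equals $\sum_{j=1}^{n-1}[b_1,c_j,c_{j+1}]$. **Projection.** For $v\in\mathbb{R}^3$ write $v=v'+v^\perp$ with $v'\in\mathbb{R}b_1$ and $v^\perp\perp b_1$. ''Projection'' means orthogonal projection along $b_1$ onto the plane through $B_1$ orthogonal to $b_1$; $B_1$ projects to itself. **Closing condition:** $b_2+\cdots+b_k=0$, i.e. $B_k=B_1$ (closed planar cyclic polygon). **Diameter condition:** the segment $B_1B_k$ is a diameter of the circle (open planar diacyclic chain). **Zigzag.** The sub-arm $b_{k+1},\dots,b_n$ (starting at $B_k$) is a zigzag if all of its edges project onto one and the same segment, so $b_i^\perp+b_{i+1}^\perp=0$ for $k+1\le i\le n-1$; condition (3) says that this common segment is a diameter of the circle in (2) (one endpoint of it is $B_k$). **Conventions.** $1\le k\le n$; the second sub-arm is empty if $k=1$ (its only vertex is then $B_1$) and the third is empty if $k=n$ (then (3) is vacuous). When $k=1$ the circle may be any circle through $B_1$, including a degenerate one of radius $0$; the diameter condition for $k=1$ forces radius $0$. **Mirror-symmetry.** The elementary mirror move at position $r$ ($2\le r\le n-1$) sends an arm to the arm in which the consecutive vectors $b_r,b_{r+1}$ are replaced by, in this order, $b_{r+1}'+\sigma(b_{r+1}^\perp)$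 and $b_r'+\sigma(b_r^\perp)$, all other vectors being unchanged. Here $\sigma$ is the reflection of the plane $b_1^\perp$ fixing $w=b_r^\perp+b_{r+1}^\perp$ if $w\neq0$, and $\sigma=-\mathrm{id}$ if $w=0$. This exchanges the lengths $l_r,l_{r+1}$, hence maps arms with one ordering of lengths to arms with a permuted ordering of $l_2,\dots,l_n$. ''Up to mirror-symmetry, the critical points are exactly the configurations of the form (F)'' means: an arm is a critical point of the signed volume function (on the parameter space of its own length vector) if and only if some finite sequence of elementary mirror moves carries it to an arm of the form (F). *)

(* Defs.v *)
From mathcomp Require Import all_boot all_order all_algebra.
From mathcomp Require Import all_classical all_reals all_analysis.

Set Implicit Arguments.
Unset Strict Implicit.
Unset Printing Implicit Defensive.

Import Order.TTheory GRing.Theory Num.Theory.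
Import numFieldNormedType.Exports.

Local Open Scope classical_set_scope.
Local Open Scope ring_scope.

Section Euclidean.
Variable R : realType.
Implicit Types u v w p q : 'rV[R]_3.

Definition dot u v : R := (u *m v^T) 0 0.

(* The norm `|u| that the library puts on row vectors is the sup norm. *)
Definition enorm u : R := Num.sqrt (dot u u).

Definition triple u v w : R := \det (\matrix_(i < 3) [:: u; v; w]`_i).

Definition segment p q : set 'rV[R]_3 :=
  [set p + t *: (q - p) | t in [set t : R | 0 <= t <= 1]].

Variable b1 : 'rV[R]_3.

(* u = axial u + perp u, with axial u in R b1 and perp u orthogonal to b1. *)
Definition axial u : 'rV[R]_3 := (dot u b1 / dot b1 b1) *: b1.
Definition perp u : 'rV[R]_3 := u - axial u.

(* B_1 is the point b1; this is the plane through B_1 orthogonal to b1, and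
   the orthogonal projection onto it. *)
Definition base_plane : set 'rV[R]_3 := [set p | dot (p - b1) b1 = 0].
Definition plane_proj p : 'rV[R]_3 := b1 + perp (p - b1).

Definition circle (c : 'rV[R]_3) (rho : R) : set 'rV[R]_3 :=
  [set p | base_plane p /\ enorm (p - c) = rho].

Definition is_diameter (c : 'rV[R]_3) (rho : R) p q : Prop :=
  [/\ circle c rho p, circle c rho q & 2^-1 *: (p + q) = c].

(* On the plane orthogonal to b1: the reflection fixing w, and -id if w = 0. *)
Definition plane_refl w u : 'rV[R]_3 :=
  if w == 0 then - u else (2 * (dot u w / dot w w)) *: w - u.

End Euclidean.

(* x is critical for the restriction of f to M: the derivative of f vanishes
   along every differentiable curve in M through x. When M is a submanifold
   (here, a product of spheres) the velocities of these curves are exactly the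
   tangent vectors of M at x. *)
Definition critical_point (R : realType) (U : normedModType R)
    (M : set U) (f : U -> R) (x : U) : Prop :=
  M x /\
  forall g : R -> U, (forall t, M (g t)) -> g 0 = x ->
    derivable g 0 1 -> is_derive (0 : R) 1 (f \o g) 0.

Section Arms.
Variables (R : realType) (n : nat) (b1 : 'rV[R]_3).

(* The rows of x are b_2, ..., b_n: row i is b_(i+2). *)
Implicit Type x : 'M[R]_(n.-1, 3).

(* b_r, for 1 <= r <= n. *)
Definition bvec x (r : nat) : 'rV[R]_3 :=
  match r with
  | 0 => 0
  | 1 => b1
  | m.+2 => if insub m is Some i then row i x else 0
  end.

(* B_j, for 1 <= j <= n. *)
Definition vertex x (j : nat) : 'rV[R]_3 := \sum_(1 <= i < j.+1) bvec x i.

Definition arm_space (l : nat -> R) : set 'M[R]_(n.-1, 3) :=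
  [set x | forall r, (2 <= r <= n)%N -> enorm (bvec x r) = l r].

Definition signed_volume x : R :=
  \sum_(2 <= j < n) triple b1 (\sum_(2 <= i < j.+1) bvec x i) (bvec x j.+1).

Definition mirror (r : nat) x : 'M[R]_(n.-1, 3) :=
  let s := plane_refl (perp b1 (bvec x r) + perp b1 (bvec x r.+1)) in
  let flip u := axial b1 u + s (perp b1 u) in
  \matrix_(i < n.-1)
    if i.+2 == r then flip (bvec x r.+1)
    else if i.+2 == r.+1 then flip (bvec x r)
    else row i x.

Definition closing x (k : nat) : Prop := \sum_(2 <= i < k.+1) bvec x i = 0.

(* The edges b_(k+1), ..., b_n all project onto the segment [p, q]. *)
Definition zigzag_onto x (k : nat) (p q : 'rV[R]_3) : Prop :=
  forall i, (k < i <= n)%N ->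
    plane_proj b1 @` segment (vertex x i.-1) (vertex x i) = segment p q.

(* The circle has centre c and radius rho; radius 0 is allowed only if
   k = 1. *)
Definition form_F x : Prop :=
  exists (k : nat) (c : 'rV[R]_3) (rho : R),
  [/\ (1 <= k <= n)%N,
      base_plane b1 c /\ (0 < rho \/ k = 1%N /\ rho = 0),
      forall i, (2 <= i <= k)%N -> dot b1 (bvec x i) = 0,
      [/\ forall j, (1 <= j <= k)%N -> circle b1 c rho (vertex x j),
          odd (n - k) -> closing x k
        & ~~ odd (n - k) -> is_diameter b1 c rho (vertex x 1) (vertex x k)]
    & (k < n)%N ->
        exists p q, zigzag_onto x k p q /\ is_diameter b1 c rho p q].

(* The positions in s are applied from left to right. *)
Definition mirror_seq (s : seq nat) x : 'M[R]_(n.-1, 3) :=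
  foldl (fun y r => mirror r y) x s.

End Arms.

(* Main.v *)
(* In the variable b_r the function V is affine with gradient b_1 x D_r, where
   D_r = (b_2 + ... + b_(r-1)) - (b_(r+1) + ... + b_n). So an arm is critical
   iff b_1 x D_r is parallel to b_r for all r, that is, iff D_r is parallel to
   b_1 or b_r is orthogonal to both b_1 and D_r. Let C be the midpoint of the
   two ends of the projected arm. The projection of D_r is twice the vector from
   C to the midpoint of the r-th projected edge; hence an arm is critical iff
   its projected vertices lie on a circle centred at C and every edge not orthogonal
   to b_1 projects to a diameter. A mirror move at r reflects the r-th projected
   vertex in the perpendicular bisector of its neighbours: it preserves this
   condition, is an involution, and exchanges the property of being a diameter
   between the edges r and r+1. Bubble sort therefore moves all diameters to the end, where
   consecutive ones form a zigzag; this is the form (F). *)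
Require Import Defs.
From mathcomp Require Import all_boot all_order all_algebra.
From mathcomp Require Import all_classical all_reals all_analysis.
From mathcomp Require Import ring lra zify.
Import Order.TTheory GRing.Theory Num.Theory.
Import numFieldNormedType.Exports.
Local Open Scope ring_scope.

(** * Coordinate identities for dot and triple products in R^3 *)

Section Vectors.
Variable R : realType.
Implicit Types u v w p q : 'rV[R]_3.

Lemma row3P u v :
  u 0 0 = v 0 0 -> u 0 1 = v 0 1 -> u 0 2 = v 0 2 -> u = v.
Proof.
move=> h0 h1 h2; apply/rowP => -[[|[|[|//]]] hj].
- by rewrite (_ : Ordinal hj = 0) //; apply: val_inj.
- by rewrite (_ : Ordinal hj = 1) //; apply: val_inj.
- by rewrite (_ : Ordinal hj = 2) //; apply: val_inj.
Qed.

Lemma dotE u v : dot u v = u 0 0 * v 0 0 + u 0 1 * v 0 1 + u 0 2 * v 0 2.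
Proof.
rewrite /dot mxE !big_ord_recl big_ord0 !mxE addr0 addrA.
have -> : lift ord0 ord0 = 1 :> 'I_3 by apply: val_inj.
by have -> : lift ord0 (lift ord0 ord0) = 2 :> 'I_3 by apply: val_inj.
Qed.

Lemma tripleE u v w : triple u v w =
  u 0 0 * (v 0 1 * w 0 2 - v 0 2 * w 0 1)
  + u 0 1 * (v 0 2 * w 0 0 - v 0 0 * w 0 2)
  + u 0 2 * (v 0 0 * w 0 1 - v 0 1 * w 0 0).
Proof.
rewrite /triple (expand_det_row _ 0) !big_ord_recl big_ord0 /cofactor.
rewrite !(expand_det_row _ 0) !big_ord_recl !big_ord0 /cofactor !det_mx11 /=.
rewrite !mxE /=.
rewrite /bump /= !addn0 !addn1 !expr0 !expr1 ?expr2.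
have -> : lift ord0 (lift ord0 ord0) = 2 :> 'I_3 by apply: val_inj.
have -> : lift (lift ord0 ord0) ord0 = 0 :> 'I_3 by apply: val_inj.
have -> : lift (lift ord0 ord0) (lift ord0 ord0) = 2 :> 'I_3 by apply: val_inj.
have -> : lift 2 ord0 = 0 :> 'I_3 by apply: val_inj.
have -> : lift 2 (lift ord0 ord0) = 1 :> 'I_3 by apply: val_inj.
have -> : lift ord0 ord0 = 1 :> 'I_3 by apply: val_inj.
have -> : lift (0 : 'I_3) (lift (lift ord0 ord0) 0) = 1 by apply: val_inj.
have -> : lift (1 : 'I_3) (lift (lift ord0 ord0) 0) = 0 by apply: val_inj.
have -> : lift (2 : 'I_3) (lift (lift ord0 ord0) 0) = 0 by apply: val_inj.
by ring.
Qed.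

Lemma dotC u v : dot u v = dot v u.
Proof. by rewrite !dotE; ring. Qed.

Lemma dotDl u v w : dot (u + v) w = dot u w + dot v w.
Proof. by rewrite !dotE !mxE; ring. Qed.

Lemma dotDr u v w : dot w (u + v) = dot w u + dot w v.
Proof. by rewrite !dotE !mxE; ring. Qed.

Lemma dotZl (a : R) u v : dot (a *: u) v = a * dot u v.
Proof. by rewrite !dotE !mxE; ring. Qed.

Lemma dotZr (a : R) u v : dot u (a *: v) = a * dot u v.
Proof. by rewrite !dotE !mxE; ring. Qed.

Lemma dotNl u v : dot (- u) v = - dot u v.
Proof. by rewrite !dotE !mxE; ring. Qed.

Lemma dotNr u v : dot u (- v) = - dot u v.
Proof. by rewrite !dotE !mxE; ring. Qed.

Lemma dot0l u : dot 0 u = 0.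
Proof. by rewrite !dotE !mxE; ring. Qed.

Definition dotL := (dotDl, dotDr, dotNl, dotNr, dotZl, dotZr).

Lemma dot_ge0 u : 0 <= dot u u.
Proof. by rewrite dotE -!expr2 !addr_ge0 ?sqr_ge0. Qed.

Lemma dot_eq0 u : (dot u u == 0) = (u == 0).
Proof.
apply/eqP/eqP => [|->]; last exact: dot0l.
move=> h; apply: row3P; rewrite mxE; move: h; rewrite dotE => h; nra.
Qed.

Lemma enorm_ge0 u : 0 <= enorm u. Proof. exact: sqrtr_ge0. Qed.

Lemma enorm_sqr u : enorm u ^+ 2 = dot u u.
Proof. by rewrite sqr_sqrtr ?dot_ge0. Qed.

(** Cramer's rule: [triple u v w *: p] is the combination of the cross products v x w, w x u, u x v
    with coefficients [dot u p], [dot v p], [dot w p]. *)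
Lemma triple_orth u v w p :
  p != 0 -> dot u p = 0 -> dot v p = 0 -> dot w p = 0 -> triple u v w = 0.
Proof.
move=> p0 up vp wp; apply/eqP; apply: contraNT p0 => t0; apply/eqP.
have cramer : triple u v w *: p = 0.
  apply: row3P; rewrite !mxE.
  - transitivity (dot u p * (v 0 1 * w 0 2 - v 0 2 * w 0 1)
      + dot v p * (w 0 1 * u 0 2 - w 0 2 * u 0 1)
      + dot w p * (u 0 1 * v 0 2 - u 0 2 * v 0 1)).
      by rewrite !dotE tripleE; ring.
    by rewrite up vp wp; ring.
  - transitivity (dot u p * (v 0 2 * w 0 0 - v 0 0 * w 0 2)
      + dot v p * (w 0 2 * u 0 0 - w 0 0 * u 0 2)
      + dot w p * (u 0 2 * v 0 0 - u 0 0 * v 0 2)).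
      by rewrite !dotE tripleE; ring.
    by rewrite up vp wp; ring.
  - transitivity (dot u p * (v 0 0 * w 0 1 - v 0 1 * w 0 0)
      + dot v p * (w 0 0 * u 0 1 - w 0 1 * u 0 0)
      + dot w p * (u 0 0 * v 0 1 - u 0 1 * v 0 0)).
      by rewrite !dotE tripleE; ring.
    by rewrite up vp wp; ring.
by move/eqP: cramer; rewrite scaler_eq0 (negPf t0) /= => /eqP.
Qed.

(** * The reflection [plane_refl w] and its action on spheres centred at 0 *)

Section Reflection.
Variable w : 'rV[R]_3.

Lemma plane_reflD u v : plane_refl w (u + v) = plane_refl w u + plane_refl w v.
Proof.
rewrite /plane_refl; case: eqP => _; first by rewrite opprD.
by rewrite dotDl [(_ + _) / _]mulrDl mulrDr scalerDl opprD addrACA.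
Qed.

Lemma plane_reflN u : plane_refl w (- u) = - plane_refl w u.
Proof.
rewrite /plane_refl; case: eqP => _ //.
by rewrite dotNl mulNr mulrN scaleNr -opprD.
Qed.

Lemma plane_refl_id : plane_refl w w = w.
Proof.
rewrite /plane_refl; case: eqVneq => [->|w0]; first exact: oppr0.
by rewrite divff ?dot_eq0 // mulr1 scaler_nat mulr2n addrK.
Qed.

Lemma plane_reflK : involutive (plane_refl w).
Proof.
move=> u; rewrite /plane_refl; case: eqVneq => [//|w0]; first by rewrite opprK.
have ww : dot w w != 0 by rewrite dot_eq0.
rewrite dotDl dotNl dotZl; apply: row3P; rewrite !mxE; field; exact: ww.
Qed.

Lemma plane_refl_dot u : dot (plane_refl w u) (plane_refl w u) = dot u u.
Proof.
rewrite /plane_refl; case: eqVneq => [//|w0]; first by rewrite !dotL opprK.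
have ww : dot w w != 0 by rewrite dot_eq0.
by rewrite !dotL (dotC w u); field; exact: ww.
Qed.

Lemma plane_refl_eq0 u : (plane_refl w u == 0) = (u == 0).
Proof. by rewrite -dot_eq0 plane_refl_dot dot_eq0. Qed.

Lemma plane_refl_perp p u :
  dot w p = 0 -> dot u p = 0 -> dot (plane_refl w u) p = 0.
Proof.
rewrite /plane_refl => wp up; case: eqP => _; rewrite !dotL ?wp up; ring.
Qed.

(* The mirror move replaces the middle one of three consecutive points [e0],
   [e], [e2] of a sphere centred at 0 by its image under the reflection that
   exchanges [e0] and [e2]. *)
Lemma plane_refl_sphere e0 e e2 e' a a' :
  w = a + a' ->
  e = e0 + a + a -> e2 = e + a' + a' ->
  e' = e0 + plane_refl w a' + plane_refl w a' ->
  dot e0 e0 = dot e e -> dot e2 e2 = dot e e ->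
  [/\ dot e' e' = dot e e,
      (e0 + e' == 0) = (e + e2 == 0) & (e' + e2 == 0) = (e0 + e == 0)].
Proof.
move=> wE eE e2E e'E h0 h2.
have e0E : e0 = e - a - a by rewrite eE !addrK.
(* For [w = 0] the neighbours [e0] and [e2] coincide and the move returns [e] itself. *)
have [w0|w0] := eqVneq w 0.
  have a'E : a' = - a by apply/eqP; rewrite -addr_eq0 addrC -wE w0.
  have -> : e' = e.
    by rewrite e'E e0E /plane_refl w0 eqxx a'E opprK; apply: row3P;
       rewrite !mxE; ring.
  by rewrite e2E a'E -e0E; split=> //; congr (_ == _); exact: addrC.
have ww : dot w w != 0 by rewrite dot_eq0.
(* Since [e2 - e0] is twice [w] and both points have the same length, minus [plane_refl w] is the
   reflection exchanging them. *)
have r2 : plane_refl w e2 = - e0.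
  have -> : plane_refl w e2 = w + w - e2.
    rewrite /plane_refl (negPf w0).
    suff -> : dot e2 w = dot w w by rewrite divff // mulr1 scaler_nat mulr2n.
    move: h0 h2; rewrite e0E e2E wE !dotL (dotC a' e) (dotC a e) (dotC a' a).
    by lra.
  by rewrite e2E e0E wE; apply: row3P; rewrite !mxE; ring.
have r0 : plane_refl w e0 = - e2.
  by rewrite -[RHS]plane_reflK plane_reflN r2 opprK.
have {}e'E : e' = - plane_refl w e.
  have -> : plane_refl w e = - e0 - plane_refl w a' - plane_refl w a'.
    by rewrite -r2 e2E !plane_reflD; apply: row3P; rewrite !mxE; ring.
  by rewrite e'E; apply: row3P; rewrite !mxE; ring.
split; first by rewrite e'E dotNl dotNr opprK plane_refl_dot.
  by rewrite e'E -[e0]opprK -r2 -opprD oppr_eq0 -plane_reflD plane_refl_eq0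
             addrC.
by rewrite e'E -[e2]opprK -r0 -opprD oppr_eq0 -plane_reflD plane_refl_eq0 addrC.
Qed.

End Reflection.

(** * Components along [b1] and orthogonal to it *)

Section Projection.
Variable b1 : 'rV[R]_3.

Lemma perpE u : perp b1 u = u - (dot u b1 / dot b1 b1) *: b1.
Proof. by []. Qed.

Lemma axialD u v : axial b1 (u + v) = axial b1 u + axial b1 v.
Proof. by rewrite /axial dotDl mulrDl scalerDl. Qed.

Lemma perpD u v : perp b1 (u + v) = perp b1 u + perp b1 v.
Proof. by rewrite /perp axialD opprD addrACA. Qed.

Lemma perpN u : perp b1 (- u) = - perp b1 u.
Proof. by rewrite !perpE dotNl mulNr scaleNr opprD. Qed.

Lemma perpZ a u : perp b1 (a *: u) = a *: perp b1 u.
Proof. by rewrite !perpE dotZl -mulrA -scalerA scalerBr. Qed.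

Lemma axial_perp u : axial b1 u + perp b1 u = u.
Proof. by rewrite addrC subrK. Qed.

Lemma dot_axial u : dot (axial b1 u) b1 = dot u b1.
Proof.
have [->|b0] := eqVneq b1 0; first by rewrite !(dotC _ 0) !dot0l.
by rewrite dotZl divfK ?dot_eq0.
Qed.

Lemma dot_perp u : dot (perp b1 u) b1 = 0.
Proof. by rewrite dotDl dotNl dot_axial subrr. Qed.

Lemma perp_orth u : dot u b1 = 0 -> perp b1 u = u.
Proof. by rewrite perpE => ->; rewrite mul0r scale0r subr0. Qed.

Lemma axial_orth u : dot u b1 = 0 -> axial b1 u = 0.
Proof. by rewrite /axial => ->; rewrite mul0r scale0r. Qed.

Lemma axial_axial u : axial b1 (axial b1 u) = axial b1 u.
Proof. by rewrite {1}/axial dot_axial. Qed.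

Lemma axial_flip u v : dot v b1 = 0 -> axial b1 (axial b1 u + v) = axial b1 u.
Proof. by move=> vb; rewrite axialD axial_axial (axial_orth v vb) addr0. Qed.

Lemma perp_flip u v : dot v b1 = 0 -> perp b1 (axial b1 u + v) = v.
Proof. by move=> vb; rewrite /perp axial_flip // addrC addKr. Qed.

End Projection.

End Vectors.

(** * Partial sums, mirror moves and the diacyclic condition *)

Section ArmCombinatorics.
Variables (R : realType) (n : nat) (b1 : 'rV[R]_3).
Implicit Types x y : 'M[R]_(n.-1, 3).

(** The position of B_j relative to B_1. *)
Definition psum x (j : nat) : 'rV[R]_3 := \sum_(2 <= i < j.+1) bvec b1 x i.

Lemma psum1 x : psum x 1 = 0.
Proof. by rewrite /psum big_geq. Qed.

Lemma psumS x j : (1 <= j)%N -> psum x j.+1 = psum x j + bvec b1 x j.+1.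
Proof. by move=> j1; rewrite /psum big_nat_recr. Qed.

Lemma psum_pred x r : (2 <= r)%N -> psum x r = psum x r.-1 + bvec b1 x r.
Proof. by case: r => [|[|r]] // _; rewrite psumS. Qed.

Lemma vertexE x j : (1 <= j)%N -> vertex b1 x j = b1 + psum x j.
Proof. by move=> j1; rewrite /vertex big_ltn. Qed.

Lemma bvec_row x (i : 'I_n.-1) : bvec b1 x i.+2 = row i x.
Proof. by rewrite /= valK. Qed.

Lemma bvec_inj x y :
  (forall i, (2 <= i <= n)%N -> bvec b1 x i = bvec b1 y i) -> x = y.
Proof.
move=> h; apply/row_matrixP => i; rewrite -!bvec_row; apply: h.
by have := ltn_ord i; lia.
Qed.

Section Move.
Variables (r : nat) (x : 'M[R]_(n.-1, 3)).
Hypothesis rn : (2 <= r < n)%N.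

Let w := perp b1 (bvec b1 x r) + perp b1 (bvec b1 x r.+1).
Let flip u := axial b1 u + plane_refl w (perp b1 u).

Lemma bvec_mirror i : bvec b1 (mirror b1 r x) i =
  if i == r then flip (bvec b1 x r.+1)
  else if i == r.+1 then flip (bvec b1 x r) else bvec b1 x i.
Proof.
case: i => [|[|m]].
- by case: eqP => [?|_]; last case: eqP => [?|_] //; lia.
- by case: eqP => [?|_]; last case: eqP => [?|_] //; lia.
rewrite {1}/bvec; case: insubP => [i im <-|nm].
  rewrite bvec_row; apply/rowP => j; rewrite !mxE.
  by case: ifP => // _; case: ifP => // _; rewrite mxE.
case: eqP => [?|_]; first by lia.
case: eqP => [?|_]; first by lia.
by rewrite /bvec insubN.
Qed.

Lemma bvec_mirror_l : bvec b1 (mirror b1 r x) r = flip (bvec b1 x r.+1).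
Proof. by rewrite bvec_mirror eqxx. Qed.

Lemma bvec_mirror_r : bvec b1 (mirror b1 r x) r.+1 = flip (bvec b1 x r).
Proof. by rewrite bvec_mirror eqxx (_ : r.+1 == r = false) //; lia. Qed.

Lemma bvec_mirror_other i :
  i != r -> i != r.+1 -> bvec b1 (mirror b1 r x) i = bvec b1 x i.
Proof. by rewrite bvec_mirror => /negPf -> /negPf ->. Qed.

Let w_orth : dot w b1 = 0.
Proof. by rewrite dotDl !dot_perp addr0. Qed.

Let flip_orth u : dot (plane_refl w (perp b1 u)) b1 = 0.
Proof. by apply: plane_refl_perp w_orth _; exact: dot_perp. Qed.

Let perp_flipE u : perp b1 (flip u) = plane_refl w (perp b1 u).
Proof. exact/perp_flip/flip_orth. Qed.

Let dot_flip u : dot (flip u) b1 = dot u b1.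
Proof. by rewrite dotDl flip_orth addr0 dot_axial. Qed.

(** A move at [r] keeps b_r + b_(r+1): the axial parts are exchanged, and the reflection fixes the
    sum [w] of the planar parts. Hence only the r-th vertex moves. *)
Lemma psum_mirror j : j != r -> psum (mirror b1 r x) j = psum x j.
Proof.
have below k : (k < r)%N -> psum (mirror b1 r x) k = psum x k.
  move=> kr; apply: eq_big_nat => i ik; apply: bvec_mirror_other; lia.
have [/below//|rj|->] := ltngtP j r; last by [].
move=> _; rewrite -(subnKC rj); elim: (j - r.+1)%N => [|k IH].
  rewrite addn0 !(psumS _ r) ?(psum_pred _ r); try lia.
  rewrite below ?bvec_mirror_l ?bvec_mirror_r; last lia.
  rewrite -[LHS]addrA -[RHS]addrA; congr (_ + _).
  rewrite /flip addrACA -plane_reflD [X in plane_refl w X]addrC -/w.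
  by rewrite plane_refl_id [axial _ _ + _]addrC addrACA !axial_perp.
rewrite addnS !(psumS _ (r.+1 + k)) ?IH ?bvec_mirror_other //; lia.
Qed.

Lemma perp_mirror_l :
  perp b1 (bvec b1 (mirror b1 r x) r) = plane_refl w (perp b1 (bvec b1 x r.+1)).
Proof. by rewrite bvec_mirror_l perp_flipE. Qed.

Lemma perp_mirror_r :
  perp b1 (bvec b1 (mirror b1 r x) r.+1) = plane_refl w (perp b1 (bvec b1 x r)).
Proof. by rewrite bvec_mirror_r perp_flipE. Qed.

Lemma axial_mirror_l :
  axial b1 (bvec b1 (mirror b1 r x) r) = axial b1 (bvec b1 x r.+1).
Proof. by rewrite bvec_mirror_l axial_flip. Qed.

Lemma axial_mirror_r :
  axial b1 (bvec b1 (mirror b1 r x) r.+1) = axial b1 (bvec b1 x r).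
Proof. by rewrite bvec_mirror_r axial_flip. Qed.

(** A second move at [r] therefore uses the same reflection, which makes the move an involution. *)
Lemma perp_mirror_sum :
  perp b1 (bvec b1 (mirror b1 r x) r) + perp b1 (bvec b1 (mirror b1 r x) r.+1)
  = w.
Proof.
by rewrite perp_mirror_l perp_mirror_r -plane_reflD addrC -/w plane_refl_id.
Qed.

End Move.

Lemma mirrorK r x : (2 <= r < n)%N -> mirror b1 r (mirror b1 r x) = x.
Proof.
move=> rn; apply: bvec_inj => i _; rewrite bvec_mirror // perp_mirror_sum //.
case: eqP => [->|/eqP ir].
  by rewrite perp_mirror_r // axial_mirror_r // plane_reflK axial_perp.
case: eqP => [->|/eqP ir1].
  by rewrite perp_mirror_l // axial_mirror_l // plane_reflK axial_perp.
by rewrite bvec_mirror_other.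
Qed.

(* Twice the vector from the centre of the projected arm (the midpoint of its
   two end points) to its [j]-th vertex. *)
Definition spoke x j := perp b1 (psum x j + psum x j - psum x n).

(** Opposite spokes at its two ends: the projected edge has its midpoint at the centre. *)
Definition diametral x r := spoke x r.-1 + spoke x r == 0.

(** The geometric condition that turns out to be equivalent to criticality. The first clause puts
    the projected vertices on a circle about the centre of the projected arm. *)
Definition diacyclic x :=
  (forall j, (1 <= j <= n)%N ->
     dot (spoke x j) (spoke x j) = dot (spoke x n) (spoke x n)) /\
  (forall r, (2 <= r <= n)%N -> dot (bvec b1 x r) b1 = 0 \/ diametral x r).

Lemma spoke_pred x r : (2 <= r)%N ->
  spoke x r = spoke x r.-1 + perp b1 (bvec b1 x r) + perp b1 (bvec b1 x r).
Proof.
move=> r2; rewrite /spoke psum_pred // -!perpD; congr (perp b1 _).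
by apply: row3P; rewrite !mxE; ring.
Qed.

Lemma spoke_mirror r x j : (2 <= r < n)%N -> j != r ->
  spoke (mirror b1 r x) j = spoke x j.
Proof. by move=> rn jr; rewrite /spoke !psum_mirror //; lia. Qed.

Definition swap_pos r i := if i == r then r.+1 else if i == r.+1 then r else i.

(** Only the r-th spoke changes; by [plane_refl_sphere] its length is kept and the midpoint
    conditions at [r] and [r.+1] are exchanged. The axial parts of the two edges are exchanged too,
    so the alternative in [diacyclic] travels with the edge. *)
Lemma mirror_diacyclic r x : (2 <= r < n)%N -> diacyclic x ->
  diacyclic (mirror b1 r x) /\
  forall i, (2 <= i <= n)%N ->
    diametral (mirror b1 r x) i = diametral x (swap_pos r i).
Proof.
move=> rn [sph orth]; set y := mirror b1 r x.
have yx j : j != r -> spoke y j = spoke x j by exact: spoke_mirror.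
have e0E : spoke y r.-1 = spoke x r.-1 by apply: yx; lia.
have r1r : r.+1 != r by lia.
have nr : n != r by lia.
have rn2 : (2 <= r <= n)%N by lia.
have rn1 : (1 <= r <= n)%N by lia.
have rSn : (2 <= r.+1 <= n)%N by lia.
have pred_r i : (2 <= i <= n)%N -> i != r.+1 -> i.-1 != r by lia.
have r2 : (2 <= r)%N by lia.
have [||||||eE d1 d2] := plane_refl_sphere R
    (perp b1 (bvec b1 x r) + perp b1 (bvec b1 x r.+1))
    (spoke y r.-1) (spoke x r) (spoke x r.+1) (spoke y r)
    (perp b1 (bvec b1 x r)) (perp b1 (bvec b1 x r.+1)).
- by [].
- by rewrite e0E; exact: spoke_pred.
- by apply: (spoke_pred x r.+1); lia.
- by rewrite -perp_mirror_l //; exact: spoke_pred.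
- by rewrite e0E !sph //; lia.
- by rewrite !sph //; lia.
have diam i : (2 <= i <= n)%N -> diametral y i = diametral x (swap_pos r i).
  move=> i_n; rewrite /swap_pos /diametral.
  case: (i =P r) => [->|/eqP ir]; first exact: d1.
  case: (i =P r.+1) => [->|/eqP ir1].
    rewrite /= -e0E -d2; congr (_ + _ == 0); exact: yx.
  by rewrite (yx i ir) (yx _ (pred_r i i_n ir1)).
split; last exact: diam.
split=> [j jn|i i_n].
  have -> : spoke y n = spoke x n by exact: yx.
  have [->|jr] := eqVneq j r; first by rewrite eE sph.
  by rewrite (yx j jr) sph.
rewrite -dot_axial (diam _ i_n) /swap_pos.
case: (i =P r) => [->|/eqP ir].
  by rewrite (axial_mirror_l _ _ rn) dot_axial; exact: orth.
case: (i =P r.+1) => [->|/eqP ir1].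
  by rewrite (axial_mirror_r _ _ rn) dot_axial; exact: orth.
by rewrite (bvec_mirror_other _ _ rn _ ir ir1) dot_axial; exact: orth.
Qed.

Lemma diacyclic_mirror r x :
  (2 <= r < n)%N -> diacyclic (mirror b1 r x) -> diacyclic x.
Proof. by move=> rn /(mirror_diacyclic _ _ rn)[]; rewrite mirrorK. Qed.

Lemma diacyclic_mirror_seq s x : (forall r, r \in s -> (2 <= r <= n.-1)%N) ->
  diacyclic (mirror_seq b1 s x) -> diacyclic x.
Proof.
elim: s x => [//|r s IH] x sn dx; apply: (diacyclic_mirror r).
  by have := sn r (mem_head _ _); lia.
by apply: IH => // i si; apply: sn; rewrite inE si orbT.
Qed.

End ArmCombinatorics.

(** * Auxiliary facts on segments, sorting and alternating sequences *)

(** Each end of one segment lies on the other, so [b - a] and [q - p] are multiples of each other by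
    factors of absolute value at most 1. This extracts the common midpoint of the projected edges of
    a zigzag. *)
Lemma segment_sum (R : realType) (a b p q : 'rV[R]_3) :
  segment a b = segment p q -> a + b = p + q.
Proof.
move=> E.
have inl (u v : 'rV[R]_3) : segment u v u.
  by exists 0; rewrite /= ?lexx ?ler01 // scale0r addr0.
have inr (u v : 'rV[R]_3) : segment u v v.
  by exists 1; rewrite /= ?lexx ?ler01 // scale1r addrC subrK.
have [s' /= /andP[s'0 s'1] aE] : segment p q a by rewrite -E.
have [t' /= /andP[t'0 t'1] bE] : segment p q b by rewrite -E.
have [s /= /andP[s0 s1] pE] : segment a b p by rewrite E.
have [t /= /andP[t0 t1] qE] : segment a b q by rewrite E.
have d1 : b - a = (t' - s') *: (q - p).
  by rewrite -aE -bE; apply: row3P; rewrite !mxE; ring.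
have d2 : q - p = (t - s) *: (b - a).
  by rewrite -pE -qE; apply: row3P; rewrite !mxE; ring.
have pqE : p + q = a + a + (s + t) *: (b - a).
  by rewrite -pE -qE; apply: row3P; rewrite !mxE; ring.
have [ba|ba] := eqVneq (b - a) 0.
  by rewrite pqE ba scaler0 addr0 -(subr0 (a + b)) -ba; apply: row3P;
     rewrite !mxE; ring.
suff st : s + t = 1 by rewrite pqE st; apply: row3P; rewrite !mxE; ring.
have /eqP : ((t' - s') * (t - s) - 1) *: (b - a) = 0.
  by rewrite scalerBl -scalerA -d2 -d1 scale1r subrr.
rewrite scaler_eq0 (negPf ba) orbF subr_eq0 => /eqP xy1.
clear -xy1 s'0 s'1 t'0 t'1 s0 s1 t0 t1.
have x1 : (t' - s') ^+ 2 <= 1 by nra.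
have y1 : (t - s) ^+ 2 <= 1 by nra.
(* The two factors have product 1 and squares at most 1; nonnegativity of the square of their
   difference forces equality. Then [s] and [t] are 0 and 1 in some order. *)
have : (t - s) ^+ 2 = 1.
  have := sqr_ge0 ((t' - s') - (t - s)); nra.
move/eqP; rewrite sqrf_eq1 => /orP[] /eqP; lra.
Qed.

(** The potential for bubble sort is the sum of the positions where the predicate fails. The
    exchange replaces the summand [r.+1] by [r]. *)
Lemma weight_swap (p q : pred nat) n r : (2 <= r < n)%N ->
  p r -> ~~ p r.+1 ->
  (forall i, (2 <= i <= n)%N -> q i = p (swap_pos r i)) ->
  (\sum_(2 <= i < n.+1) i * ~~ q i < \sum_(2 <= i < n.+1) i * ~~ p i)%N.
Proof.
move=> /andP[r2 rn] pr pr1 qE.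
have split_sum (F : nat -> nat) : (\sum_(2 <= i < n.+1) F i =
    \sum_(2 <= i < r) F i + (F r + (F r.+1 + \sum_(r.+2 <= i < n.+1) F i)))%N.
  rewrite (@big_cat_nat _ _ _ r) //=; last by apply: ltnW; rewrite ltnS ltnW.
  by rewrite (@big_ltn _ _ _ r) ?(@big_ltn _ _ _ r.+1) ?ltnS // ltnW.
rewrite !split_sum.
have -> : q r = p r.+1 by rewrite qE /swap_pos ?eqxx // r2 ltnW.
have -> : q r.+1 = p r.
  by rewrite qE /swap_pos ?eqxx ?gtn_eqF // rn (leq_trans r2).
have other i : (2 <= i <= n)%N -> i != r -> i != r.+1 -> q i = p i.
  by move=> i_n ir ir1; rewrite qE // /swap_pos (negPf ir) (negPf ir1).
rewrite pr (negPf pr1) /= !muln0 !muln1 !add0n.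
rewrite [X in (X + _ < _)%N](eq_big_nat _ _
  (F2 := fun i => (i * ~~ p i)%N)); last first.
  by move=> i /andP[i2 ir]; rewrite other ?i2 //; lia.
rewrite [X in (_ + (r + X) < _)%N](eq_big_nat _ _
  (F2 := fun i => (i * ~~ p i)%N)); last first.
  by move=> i /andP[i2 ir]; rewrite other //; lia.
by rewrite ltn_add2l addSn.
Qed.

Lemma alternating (V : zmodType) (f : nat -> V) k n :
  (forall i, (k < i <= n)%N -> f i.-1 + f i = 0) ->
  forall j, (k <= j <= n)%N -> f j = if odd (j - k) then - f k else f k.
Proof.
move=> alt j /andP[/subnKC <-]; rewrite addKn.
elim: (j - k)%N => [|m IH] kmn; first by rewrite addn0.
have := alt (k + m.+1)%N; rewrite addnS /= ltnS leq_addr -addnS kmn => /(_ isT).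
rewrite IH; last by apply: leq_trans kmn; rewrite addnS.
move/eqP; rewrite addrC addr_eq0 => /eqP ->.
by case: (odd m); rewrite ?opprK.
Qed.

Lemma segmentC (R : realType) (p q : 'rV[R]_3) : segment p q = segment q p.
Proof.
suff sub (u v : 'rV[R]_3) : (segment u v `<=` segment v u)%classic.
  by apply/seteqP; split; exact: sub.
move=> _ [t /= /andP[t0 t1] <-]; exists (1 - t) => /=; first lra.
by apply: row3P; rewrite !mxE; ring.
Qed.

(** * Bubble sort of the diameters, and form (F) against the diacyclic condition *)

Section Forms.
Variables (R : realType) (n : nat) (b1 : 'rV[R]_3).
Implicit Types x y : 'M[R]_(n.-1, 3).

(** While a diametral position is followed by a non-diametral one, a move there exchanges them and
    lowers [weight], on which the induction runs. *)
Lemma diametral_sorted x : diacyclic R n b1 x ->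
  exists s, [/\ forall r, r \in s -> (2 <= r <= n.-1)%N,
    diacyclic R n b1 (mirror_seq b1 s x) &
    forall r, (2 <= r < n)%N -> diametral R n b1 (mirror_seq b1 s x) r ->
      diametral R n b1 (mirror_seq b1 s x) r.+1].
Proof.
pose weight y := (\sum_(2 <= i < n.+1) i * ~~ diametral R n b1 y i)%N.
have [m] := ubnP (weight x); elim: m x => // m IH x xm dx.
have [/existsP[r /andP[r2 /andP[dr dr1]]]|/existsPn nex] := boolP
    [exists r : 'I_n, (2 <= r)%N && (diametral R n b1 x r
                                    && ~~ diametral R n b1 x r.+1)]; last first.
  exists [::]; split=> // r /andP[r2 rn] dr; have := nex (Ordinal rn).
  by rewrite r2 /= dr /= negbK.
have rn : (2 <= r < n)%N by rewrite r2 ltn_ord.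
have [dy swapE] := mirror_diacyclic R n b1 _ _ rn dx.
have wy : (weight (mirror b1 r x) < m)%N.
  by rewrite ltnS in xm; apply: leq_trans xm; apply: weight_swap swapE.
have [s [sn ds ss]] := IH _ wy dy.
exists (nat_of_ord r :: s); split=> // i; rewrite inE => /orP[/eqP->|/sn//].
by rewrite r2 -ltnS (ltn_predK (ltn_ord r)) ltn_ord.
Qed.

Lemma plane_proj_segment (u v : 'rV[R]_3) :
  (plane_proj b1 @` segment u v)%classic
  = segment (plane_proj b1 u) (plane_proj b1 v).
Proof.
have E t : plane_proj b1 (u + t *: (v - u)) =
    plane_proj b1 u + t *: (plane_proj b1 v - plane_proj b1 u).
  rewrite /plane_proj.
  have -> : u + t *: (v - u) - b1 = (u - b1) + t *: ((v - b1) - (u - b1)).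
    by apply: row3P; rewrite !mxE; ring.
  move: (u - b1) (v - b1) => u' v'; rewrite !(perpD, perpZ, perpN).
  by apply: row3P; rewrite !mxE; ring.
apply/seteqP; split=> [_ [_ [t t01 <-] <-]|_ [t t01 <-]].
  by exists t.
by exists (u + t *: (v - u)) => //; exists t.
Qed.

(** The midpoint of the projections of B_1 and B_n. *)
Definition centre x := b1 + 2^-1 *: perp b1 (psum R n b1 x n).

Lemma proj_vertex x j : (1 <= j)%N ->
  plane_proj b1 (vertex b1 x j) = centre x + 2^-1 *: spoke R n b1 x j.
Proof.
move=> j1; rewrite /plane_proj vertexE // (addrC b1 (psum _ _ _ _ _)) addrK.
rewrite /centre /spoke !(perpD, perpN).
move: (perp b1 (psum _ _ _ _ j)) (perp b1 (psum _ _ _ _ n)) => u v.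
by apply: row3P; rewrite !mxE; field.
Qed.

Lemma psum_orth x k : (forall i, (2 <= i <= k)%N -> dot b1 (bvec b1 x i) = 0) ->
  forall j, (j <= k)%N -> dot (psum R n b1 x j) b1 = 0.
Proof.
move=> orth j jk; rewrite /psum big_nat_cond.
apply: (big_ind (fun u => dot u b1 = 0)).
- exact: dot0l.
- by move=> u v hu hv; rewrite dotDl hu hv addr0.
- by move=> i; rewrite andbT => /andP[i2 ij]; rewrite dotC orth ?i2 //; lia.
Qed.

Lemma plane_vertex x k :
  (forall i, (2 <= i <= k)%N -> dot b1 (bvec b1 x i) = 0) ->
  forall j, (1 <= j <= k)%N -> plane_proj b1 (vertex b1 x j) = vertex b1 x j.
Proof.
move=> orth j /andP[j1 jk]; rewrite /plane_proj vertexE //.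
have -> : b1 + psum R n b1 x j - b1 = psum R n b1 x j by rewrite addrC addKr.
by rewrite perp_orth // (psum_orth _ _ orth).
Qed.

Lemma spoke_orth x j : dot (spoke R n b1 x j) b1 = 0.
Proof. exact: dot_perp. Qed.

Lemma spoke_ends x : spoke R n b1 x 1 = - spoke R n b1 x n.
Proof. by rewrite /spoke psum1 add0r sub0r addrK perpN. Qed.

Lemma enormZ a (u : 'rV[R]_3) : enorm (a *: u) = `|a| * enorm u.
Proof.
by rewrite /enorm dotZl dotZr mulrA -expr2 sqrtrM ?sqr_ge0 // sqrtr_sqr.
Qed.

(** The vectors [f j] from [c] to the projected vertices alternate in sign along the zigzag. The
    parity condition then makes the two ends antipodal, which forces [c] to be [centre x]; so the
    spokes are [2 *: f j] and both clauses can be read off. *)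
Lemma form_diacyclic x : (2 <= n)%N -> form_F b1 x -> diacyclic R n b1 x.
Proof.
move=> n2 [k [c [rho [/andP[k1 kn] _ orth [circ clos diamk] zig]]]].
pose f j := plane_proj b1 (vertex b1 x j) - c.
have fE j : (1 <= j <= k)%N -> f j = vertex b1 x j - c.
  by move=> jk; rewrite /f (plane_vertex _ _ orth).
have k_n : (k <= n <= n)%N by rewrite kn leqnn.
have n1 : (1 <= n)%N by exact: ltnW.
have kk : (1 <= k <= k)%N by rewrite k1 leqnn.
have k11 : (1 <= 1 <= k)%N by [].
have alt i : (k < i <= n)%N -> f i.-1 + f i = 0.
  move=> /andP[ki i_n]; have [p [q [zpq [_ _ pqc]]]] := zig (leq_trans ki i_n).
  have /segment_sum : segment (plane_proj b1 (vertex b1 x i.-1))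
      (plane_proj b1 (vertex b1 x i)) = segment p q.
    by rewrite -plane_proj_segment; apply: zpq; rewrite ki i_n.
  rewrite /f -pqc => E; rewrite addrACA E -opprD -scalerDl.
  by rewrite (_ : 2^-1 + 2^-1 = 1 :> R) ?scale1r ?subrr //; field.
have fj := alternating _ f k n alt.
(* For n - k odd, [f n = - f k] and B_k = B_1; for n - k even, [f n = f k] and [c] is the midpoint
   of B_1 and B_k. *)
have fn : f n = - f 1%N.
  rewrite (fj n k_n); case: ifPn => [/clos cl|/diamk [_ _ cE]].
    rewrite !fE // !vertexE // psum1 (_ : psum R n b1 x k = 0) //.
  apply/eqP; rewrite -addr_eq0 !fE // addrACA -opprD -cE -scalerDl.
  rewrite (_ : 2^-1 + 2^-1 = 1 :> R); last by field.
  by rewrite scale1r (addrC (vertex b1 x k)) subrr.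
have cE : c = centre x.
  have : f n + f 1%N = 0 by rewrite fn addNr.
  rewrite /f !proj_vertex // spoke_ends scalerN.
  move: (centre x) (2^-1 *: _) => u v E.
  suff : u - c = 0 by move/eqP; rewrite subr_eq0 => /eqP.
  have -> : u - c = 2^-1 *: (u + v - c + (u - v - c)).
    by apply: row3P; rewrite !mxE; field.
  by rewrite E scaler0.
have spokeE j : (1 <= j)%N -> spoke R n b1 x j = 2 *: f j.
  move=> j1; rewrite /f proj_vertex // cE addrC addKr scalerA.
  by rewrite mulfV ?scale1r // pnatr_eq0.
have f_rho j : (1 <= j <= n)%N -> dot (f j) (f j) = rho ^+ 2.
  have below i : (1 <= i <= k)%N -> dot (f i) (f i) = rho ^+ 2.
    by move=> ik; have [_ <-] := circ i ik; rewrite enorm_sqr fE.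
  move=> /andP[j1 jn]; have [jk|/ltnW kj] := leqP j k.
    by apply: below; rewrite j1.
  rewrite (fj j) ?kj // -(below k) //.
  by case: ifP => // _; rewrite dotNl dotNr opprK.
split=> [j jn|r /andP[r2 rn]].
  case/andP: (jn) => j1 _.
  have nn : (1 <= n <= n)%N by rewrite n1 leqnn.
  by rewrite (spokeE _ j1) (spokeE _ n1) !dotZl !dotZr (f_rho _ jn)
             (f_rho _ nn).
have [rk|kr] := leqP r k; first by left; rewrite dotC orth // r2.
right; have r1 : (1 <= r.-1)%N by case: (r) r2 => [|[]].
have krn : (k < r <= n)%N by rewrite kr.
rewrite /diametral (spokeE _ r1) (spokeE _ (ltnW r2)) -scalerDr (alt _ krn).
by rewrite scaler0.
Qed.

End Forms.

(** The edges before the diameters are orthogonal to [b1] by the second clause of [diacyclic].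
    Beyond [k] the spokes alternate in sign, so the antipodality of the first and last spokes
    becomes the closing or the diameter condition according to parity. *)
Lemma sorted_form (R : realType) (n : nat) (b1 : 'rV[R]_3)
    (x : 'M[R]_(n.-1, 3)) :
  (2 <= n)%N -> diacyclic R n b1 x ->
  (forall r, (2 <= r < n)%N -> diametral R n b1 x r ->
     diametral R n b1 x r.+1) ->
  form_F b1 x.
Proof.
move=> n2 [sph orth] sorted.
have n1 : (1 <= n)%N by exact: ltnW.
have nn : (1 <= n <= n)%N by rewrite n1 leqnn.
(* [k] is the position just before the first diametral edge, or [n] if there is none. *)
have [k [k1n nodiam diam]] : exists k, [/\ (1 <= k <= n)%N,
    forall r, (2 <= r <= k)%N -> ~~ diametral R n b1 x r &
    forall r, (k < r <= n)%N -> diametral R n b1 x r].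
  have [ex|nex] := pselect (exists r, (2 <= r <= n)%N && diametral R n b1 x r);
    last first.
    exists n; split=> // r rn.
      by apply/negP => d; case: nex; exists r; rewrite rn.
    by move: rn; rewrite andbC ltnNge; case: leqP.
  case: (ex_minnP ex) => r /andP[/andP[r2 rn] dr] rmin; exists r.-1.
  have rE : r.-1.+1 = r by rewrite prednK // ltnW.
  split=> [|i /andP[i2 ir]|i].
  - by rewrite -ltnS rE r2 (leq_trans (leq_pred r)).
  - apply/negP => di; have := rmin i; rewrite di i2 andbT.
    rewrite (leq_trans ir) ?(leq_trans (leq_pred r)) // => /(_ isT).
    by rewrite leqNgt -rE ltnS ir.
  rewrite rE => /andP[/subnKC <-]; elim: (i - r)%N => [|m IH].
    by rewrite addn0.
  rewrite addnS => rmn; apply: sorted; last by apply: IH; exact: ltnW.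
  by rewrite rmn (leq_trans r2) ?leq_addr.
pose e := spoke R n b1 x; pose c := centre R n b1 x.
(* Spokes are twice the radius vectors, hence the factor 1/2. *)
pose rho := enorm (2^-1 *: e n).
have alt := alternating _ e k n (fun i ik => eqP (diam i ik)).
have orthk i : (2 <= i <= k)%N -> dot b1 (bvec b1 x i) = 0.
  move=> /andP[i2 ik]; have i_n : (2 <= i <= n)%N.
    by rewrite i2 (leq_trans ik) //; case/andP: k1n.
  have ik2 : (2 <= i <= k)%N by rewrite i2.
  case: (orth i i_n) => [|d]; first by rewrite dotC.
  by have := nodiam i ik2; rewrite d.
have vE j : (1 <= j <= k)%N -> vertex b1 x j = c + 2^-1 *: e j.
  move=> jk; rewrite -(plane_vertex _ _ _ _ _ orthk j jk).
  by apply: proj_vertex; case/andP: jk.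
have circ v : dot v b1 = 0 -> dot v v = dot (e n) (e n) ->
    circle b1 c rho (c + 2^-1 *: v).
  move=> vb vv; split; last first.
    have -> : c + 2^-1 *: v - c = 2^-1 *: v by rewrite addrC addKr.
    rewrite /rho !enormZ /enorm vv; reflexivity.
  rewrite /base_plane /= /c /centre.
  have -> : b1 + 2^-1 *: perp b1 (psum R n b1 x n) + 2^-1 *: v - b1
     = 2^-1 *: perp b1 (psum R n b1 x n) + 2^-1 *: v.
    by apply: row3P; rewrite !mxE; ring.
  by rewrite dotDl !dotZl dot_perp vb !mulr0 addr0.
have circe j : (1 <= j <= n)%N -> circle b1 c rho (c + 2^-1 *: e j).
  by move=> jn; apply: circ; [exact: spoke_orth | exact: sph].
have diamv v : circle b1 c rho (c + 2^-1 *: v) ->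
    circle b1 c rho (c + 2^-1 *: - v) ->
    is_diameter b1 c rho (c + 2^-1 *: v) (c + 2^-1 *: - v).
  move=> h h'; split=> //.
  rewrite scalerN addrACA subrr addr0 scalerDr -scalerDl.
  by rewrite (_ : 2^-1 + 2^-1 = 1 :> R) ?scale1r //; field.
have /andP[k1 kn] := k1n.
have k_n : (k <= n <= n)%N by rewrite kn leqnn.
have e1 : e 1%N = - e n by exact: spoke_ends.
exists k, c, rho; split.
- exact: k1n.
- split.
    rewrite /base_plane /= /c /centre.
    have -> : b1 + 2^-1 *: perp b1 (psum R n b1 x n) - b1
       = 2^-1 *: perp b1 (psum R n b1 x n) by rewrite addrC addKr.
    by rewrite dotZl dot_perp mulr0.
  (* Radius 0 makes all spokes vanish, so already b_2 is diametral and [k] must be 1. *)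
  have [rho0|rho0] := ltP 0 rho; [by left | right].
  have {}rho0 : rho = 0 by apply/eqP; rewrite eq_le rho0 enorm_ge0.
  split=> //; apply/eqP; rewrite eqn_leq k1 andbT leqNgt; apply/negP => k2.
  have en0 : e n = 0.
    move/eqP: rho0; rewrite -sqrf_eq0 enorm_sqr dot_eq0 scaler_eq0.
    by rewrite invr_eq0 pnatr_eq0 => /eqP.
  have ej0 j : (1 <= j <= n)%N -> e j = 0.
    by move=> jn; apply/eqP; rewrite -dot_eq0 (sph j jn) -/e en0 dot0l.
  have k22 : (2 <= 2 <= k)%N by [].
  have := nodiam _ k22; rewrite /diametral /= -/e.
  by rewrite (ej0 1%N) ?n1 // (ej0 2%N) ?n2 // addr0 eqxx.
- exact: orthk.
- split=> [j jk|ok|ek].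
  + have jn : (1 <= j <= n)%N.
      by case/andP: jk => -> jk; exact: leq_trans jk kn.
    by rewrite (vE j jk); exact: circe.
  + have := alt n k_n; rewrite ok => enk.
    have kk : (1 <= k <= k)%N by rewrite k1 leqnn.
    have k11 : (1 <= 1 <= k)%N by [].
    have : vertex b1 x k = vertex b1 x 1.
      by rewrite (vE k kk) (vE _ k11) e1 enk opprK.
    rewrite !vertexE // psum1 => /addrI; exact.
  + have := alt n k_n; rewrite (negPf ek) => enk.
    have kk : (1 <= k <= k)%N by rewrite k1 leqnn.
    have k11 : (1 <= 1 <= k)%N by [].
    rewrite (vE k kk) (vE _ k11) -enk e1.
    have := diamv (- e n); rewrite opprK; apply; last exact: circe.
    by rewrite -e1; apply: circe; rewrite n1.
(* The diameter from B_k to its antipode. *)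
move=> ltkn; exists (c + 2^-1 *: e k), (c + 2^-1 *: - e k).
have ckm : circle b1 c rho (c + 2^-1 *: - e k).
  apply: circ; first by rewrite dotNl spoke_orth oppr0.
  by rewrite dotNl dotNr opprK; exact: sph.
split; last by apply: diamv => //; exact: circe.
move=> i /andP[ki i_n].
have i1 : (1 <= i)%N by exact: leq_trans ki.
have pi1 : (1 <= i.-1)%N by rewrite -ltnS (ltn_predK ki) (leq_trans _ ki).
rewrite plane_proj_segment (proj_vertex _ _ _ _ _ pi1).
rewrite (proj_vertex _ _ _ _ _ i1).
rewrite -/c -/e.
have kin : (k <= i <= n)%N by rewrite (ltnW ki).
have pkin : (k <= i.-1 <= n)%N.
  by case: (i) ki i_n => // i' /= ki i_n; rewrite -ltnS ki ltnW.
(* The distances of [i] and [i.-1] from [k] have opposite parity, so the projected edge is this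
   diameter in one of its two orientations. *)
rewrite (alt _ kin) (alt _ pkin).
have -> : (i - k = (i.-1 - k).+1)%N.
  by case: (i) ki => // i' /= ki; rewrite subSn.
by rewrite /=; case: ifP => _ //=; exact: segmentC.
Qed.

(** * First variation of the signed volume *)

Section Derivative.
Variables (R : realType) (n : nat) (b1 : 'rV[R]_3).
Implicit Types (x h : 'M[R]_(n.-1, 3)) (u v w : 'rV[R]_3) (f g : R -> R).

Lemma is_derive_sum_seq I (s : seq I) (f : I -> R -> R) (df : I -> R) :
  (forall i, is_derive (0 : R) 1 (f i) (df i)) ->
  is_derive (0 : R) 1 (fun t => \sum_(i <- s) f i t) (\sum_(i <- s) df i).
Proof.
move=> fd; elim: s => [|i s IH].
  rewrite big_nil (_ : (fun _ => _) = cst 0); first exact: is_derive_cst.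
  by apply/funext => t; rewrite big_nil.
rewrite big_cons (_ : (fun _ => _) = f i + (fun t => \sum_(j <- s) f j t)).
  exact: is_deriveD.
by apply/funext => t; rewrite big_cons.
Qed.

Lemma is_derive_triple (u v : R -> 'rV[R]_3) u' v' :
  (forall j, is_derive (0 : R) 1 (fun t => u t 0 j) (u' 0 j)) ->
  (forall j, is_derive (0 : R) 1 (fun t => v t 0 j) (v' 0 j)) ->
  is_derive (0 : R) 1 (fun t => triple b1 (u t) (v t))
    (triple b1 u' (v 0) + triple b1 (u 0) v').
Proof.
move=> du dv.
pose m (i j : 'I_3) : R -> R := (fun t => u t 0 i) * (fun t => v t 0 j).
have dm i j : is_derive (0 : R) 1 (m i j) (u 0 0 i * v' 0 j + v 0 0 j * u' 0 i).
  exact: is_deriveM.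
rewrite (_ : (fun t => _) = b1 0 0 \*: (m 1 2 - m 2 1)
  + b1 0 1 \*: (m 2 0 - m 0 2) + b1 0 2 \*: (m 0 1 - m 1 0)); last first.
  by apply/funext => t; rewrite tripleE.
clearbody m; apply: is_derive_eq; rewrite !tripleE /GRing.scale /=.
move: (u 0 0 0) (u 0 0 1) (u 0 0 2) (u' 0 0) (u' 0 1) (u' 0 2) => *.
by move: (v 0 0 0) (v 0 0 1) (v 0 0 2) (v' 0 0) (v' 0 1) (v' 0 2) => *; ring.
Qed.

Lemma is_derive_dot (u : R -> 'rV[R]_3) u' :
  (forall j, is_derive (0 : R) 1 (fun t => u t 0 j) (u' 0 j)) ->
  is_derive (0 : R) 1 (fun t => dot (u t) (u t)) (2 * dot u' (u 0)).
Proof.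
move=> du.
pose m (j : 'I_3) : R -> R := (fun t => u t 0 j) * (fun t => u t 0 j).
have dm j : is_derive (0 : R) 1 (m j) (u 0 0 j * u' 0 j + u 0 0 j * u' 0 j).
  exact: is_deriveM.
rewrite (_ : (fun t => _) = m 0 + m 1 + m 2); last first.
  by apply/funext => t; rewrite dotE.
clearbody m; apply: is_derive_eq; rewrite dotE.
by move: (u 0 0 0) (u 0 0 1) (u 0 0 2) (u' 0 0) (u' 0 1) (u' 0 2) => *; ring.
Qed.

Lemma tripleDr u v w w' : triple u v (w + w') = triple u v w + triple u v w'.
Proof. by rewrite !tripleE !mxE; ring. Qed.

Lemma triple0r u v : triple u v 0 = 0.
Proof. by rewrite !tripleE !mxE; ring. Qed.

Lemma tripleZr a u v w : triple u v (a *: w) = a * triple u v w.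
Proof. by rewrite !tripleE !mxE; ring. Qed.

Lemma triple_sumr u v I (s : seq I) (F : I -> 'rV[R]_3) :
  triple u v (\sum_(i <- s) F i) = \sum_(i <- s) triple u v (F i).
Proof. exact: (big_morph _ (tripleDr u v) (triple0r u v)). Qed.

(** Summation by parts regroups the variation by edges. In the induction the new edge [b m.+1] is
    subtracted from every old coefficient, and [h m.+1] enters with coefficient [S m]. *)
Lemma volume_variation m (b h : nat -> 'rV[R]_3) :
  let S j := \sum_(2 <= i < j.+1) b i in
  (2 <= m)%N ->
  \sum_(2 <= j < m) (triple b1 (\sum_(2 <= i < j.+1) h i) (b j.+1)
                     + triple b1 (S j) (h j.+1))
  = \sum_(2 <= r < m.+1) triple b1 (S r.-1 + S r - S m) (h r).
Proof.
move=> S; elim: m => [//|m IH]; rewrite ltnS leq_eqVlt => /orP[/eqP <-|m2].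
  rewrite big_geq // big_nat1 /= addrK /S (big_geq (leqnn 2)).
  by rewrite tripleE !mxE; ring.
have Sm : S m.+1 = S m + b m.+1 by rewrite /S big_nat_recr //= ltnW.
rewrite (big_nat_recr m) // IH // (big_nat_recr m.+1) ?(leqW m2) //=.
rewrite addrK.
have split_last r : triple b1 (S r.-1 + S r - S m.+1) (h r) =
    triple b1 (S r.-1 + S r - S m) (h r) - triple b1 (b m.+1) (h r).
  by rewrite Sm !tripleE !mxE; ring.
rewrite (eq_bigr _ (fun r _ => split_last r)) sumrB -triple_sumr.
by rewrite addrA; congr (_ + _ + _); rewrite !tripleE; ring.
Qed.

(** The vector D_r: the sum of the edges from b_2 on that precede b_r, minus the sum of those that
    follow it. *)
Definition lever x r := psum R n b1 x r.-1 + psum R n b1 x r - psum R n b1 x n.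

(** The first vector of the arm is constant along the curve, so the velocity [h] is read with first
    vector 0. *)
Lemma is_derive_bvec (g : R -> 'M[R]_(n.-1, 3)) h :
  (forall i j, is_derive (0 : R) 1 (fun t => g t i j) (h i j)) ->
  forall r j,
    is_derive (0 : R) 1 (fun t => bvec b1 (g t) r 0 j) (bvec 0 h r 0 j).
Proof.
move=> gh r j.
case: r => [|[|r]]; try by rewrite /= mxE; exact: is_derive_cst.
rewrite /bvec; case: insubP => [i _ _|_].
  rewrite (_ : (fun t => _) = (fun t => g t i j)) ?mxE //.
  by apply/funext => t; rewrite mxE.
by rewrite mxE; exact: is_derive_cst.
Qed.

Lemma is_derive_signed_volume (g : R -> 'M[R]_(n.-1, 3)) h :
  (2 <= n)%N ->
  (forall i j, is_derive (0 : R) 1 (fun t => g t i j) (h i j)) ->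
  is_derive (0 : R) 1 (signed_volume b1 \o g)
    (\sum_(2 <= r < n.+1) triple b1 (lever (g 0) r) (bvec 0 h r)).
Proof.
move=> n2 gh.
have db := is_derive_bvec _ _ gh.
rewrite -volume_variation //; apply: is_derive_sum_seq => k.
pose S t := \sum_(2 <= i < k.+1) bvec b1 (g t) i.
apply: (is_derive_triple S) => // j.
rewrite summxE (_ : (fun t => _) =
  (fun t => \sum_(2 <= i < k.+1) bvec b1 (g t) i 0 j)).
  exact: is_derive_sum_seq.
by apply/funext => t; rewrite summxE.
Qed.

Definition set_edge r u x : 'M[R]_(n.-1, 3) :=
  \matrix_(i < n.-1) if i.+2 == r then u else row i x.

Lemma bvec_set_edge (a : 'rV[R]_3) r u x i : (2 <= r <= n)%N ->
  bvec a (set_edge r u x) i = if i == r then u else bvec a x i.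
Proof.
move=> rn; case: i => [|[|m]].
- by case: eqP => // ?; lia.
- by case: eqP => // ?; lia.
rewrite /bvec; case: insubP => [i im <-|nm]; last by case: eqP => // ?; lia.
by apply/rowP => j; rewrite !mxE; case: ifP => // _; rewrite mxE.
Qed.

Lemma dot_rotation u v t : dot v u = 0 -> dot v v = dot u u ->
  dot (cos t *: u + sin t *: v) (cos t *: u + sin t *: v) = dot u u.
Proof.
move=> vu vv; rewrite !dotL (dotC _ u v) vu vv.
transitivity ((cos t ^+ 2 + sin t ^+ 2) * dot u u); first by ring.
by rewrite cos2Dsin2 mul1r.
Qed.

(** Necessity is tested on curves that rotate a single edge along a great circle. For sufficiency,
    every edge of a curve in the product of spheres has velocity orthogonal to itself, so each term
    of the first variation vanishes. *)
Lemma critical_lever (l : nat -> R) x : (2 <= n)%N -> arm_space b1 l x ->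
  (forall r, (2 <= r <= n)%N -> bvec b1 x r != 0) ->
  critical_point (arm_space b1 l) (signed_volume b1) x <->
  forall r v, (2 <= r <= n)%N -> dot v (bvec b1 x r) = 0 ->
    triple b1 (lever x r) v = 0.
Proof.
move=> n2 xM b0; split=> [[_ crit] r v rn vb|lev].
  have [->|v0] := eqVneq v 0; first exact: triple0r.
  set b := bvec b1 x r in vb *.
  (* Rescaled to the length of [b], so that the rotation below stays on the sphere. *)
  pose v' := (enorm b / enorm v) *: v.
  have nz w : w != 0 -> enorm w != 0 by rewrite -sqrf_eq0 enorm_sqr dot_eq0.
  have v'b : dot v' b = 0 by rewrite dotZl vb mulr0.
  have v'v' : dot v' v' = dot b b.
    rewrite dotZl dotZr -!enorm_sqr; field; exact: nz.
  pose g t := set_edge r (cos t *: b + sin t *: v') x.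
  have gM t : arm_space b1 l (g t).
    move=> i i_n; rewrite bvec_set_edge //; case: eqP => [->|_]; last exact: xM.
    rewrite -(xM r rn) /enorm; congr Num.sqrt.
    exact: dot_rotation.
  have g0 : g 0 = x.
    apply: (bvec_inj _ _ b1) => i i_n; rewrite bvec_set_edge //.
    by case: eqP => // ->; rewrite cos0 sin0 scale1r scale0r addr0.
  pose h := set_edge r v' 0.
  have gh i j : is_derive (0 : R) 1 (fun t => g t i j) (h i j).
    rewrite /g /h !mxE; case: (i.+2 =P r) => ir; last first.
      rewrite (_ : (fun t => _) = cst (x i j)) ?mxE; first exact: is_derive_cst.
      by apply/funext => t; rewrite !mxE; case: eqP => //; rewrite mxE.
    rewrite (_ : (fun t => _) = b 0 j \*: cos + v' 0 j \*: sin); last first.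
      apply/funext => t; rewrite !mxE ir eqxx !mxE /GRing.scale /=.
      by rewrite mulrC [sin t * _]mulrC.
    apply: is_derive_eq.
    by rewrite sin0 cos0 oppr0 /GRing.scale /= mulr0 mulr1 add0r.
  have gd : derivable g 0 1.
    by apply/derivable_mxP => i j; have := gh i j => -[].
  have bvec0 i : (2 <= i)%N -> bvec 0 (0 : 'M[R]_(n.-1, 3)) i = 0.
    case: i => [|[|i]] // _; rewrite /bvec; case: insubP => // k _ _.
    by apply/rowP => j; rewrite !mxE.
  have := is_derive_signed_volume _ _ n2 gh; rewrite g0 => -[_].
  have [_ ->] := crit g gM g0 gd.
  (* Only the edge [r] moves, so a single summand survives; the scaling factor in [v'] is
     nonzero. *)
  rewrite (bigD1_seq r) ?iota_uniq ?mem_index_iota //= big_nat_cond big1.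
    rewrite addr0 bvec_set_edge // eqxx /v' tripleZr => /esym/eqP.
    by rewrite mulf_eq0 mulf_eq0 invr_eq0 !(negPf (nz _ _)) ?b0 // => /eqP.
  move=> i /andP[/andP[i2 i_n] /negPf ir].
  by rewrite bvec_set_edge // ir bvec0 // triple0r.
split=> // g gM g0 /derivable_mxP gd.
pose h : 'M[R]_(n.-1, 3) := \matrix_(i, j) 'D_1 (fun t => g t i j) 0.
have gh i j : is_derive (0 : R) 1 (fun t => g t i j) (h i j).
  by rewrite mxE; exact: derivableP.
apply: is_derive_eq; first exact: (is_derive_signed_volume _ _ n2 gh).
rewrite g0 big_nat big1 // => r rn.
apply: lev => //.
(* Differentiating the constant squared length shows that the velocity of the edge is tangent. *)
have db := is_derive_dot _ _ (is_derive_bvec _ _ gh r).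
have cst_norm :
    (fun t => dot (bvec b1 (g t) r) (bvec b1 (g t) r)) = cst (l r ^+ 2).
  by apply/funext => t; rewrite -enorm_sqr gM.
move: db; rewrite cst_norm g0 => -[_]; rewrite derive_cst => /esym/eqP.
by rewrite mulf_eq0 pnatr_eq0 => /eqP.
Qed.

End Derivative.

(** * From levers to the diacyclic condition *)

Section LeverConditions.
Variables (R : realType) (n : nat) (b1 : 'rV[R]_3).
Implicit Types (x : 'M[R]_(n.-1, 3)) (u v w d b : 'rV[R]_3).

(** The functional is the dot product with the cross product of [b1] and [d], so it vanishes on the
    complement of [b] iff that cross product is a multiple of [b]. A zero multiple means that [d] is
    parallel to [b1]; a nonzero one makes [b] orthogonal to both. *)
Lemma triple_tangent_eq0 d b : b1 != 0 -> b != 0 ->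
  (forall v, dot v b = 0 -> triple b1 d v = 0) <->
  perp b1 d = 0 \/ dot b b1 = 0 /\ dot b d = 0.
Proof.
move=> b10 b0; split=> [H|[d0|[bb1 bd]] v vb].
- (* the cross product of [b1] and [d] *)
  pose m : 'rV[R]_3 := \row_j triple b1 d (delta_mx 0 j).
  have mE v : triple b1 d v = dot m v.
    rewrite dotE !mxE !tripleE !mxE /=; ring.
  have mperp : perp b m = 0.
    have := H (perp b m) (dot_perp _ _ _); rewrite mE -{1}(axial_perp _ b m).
    rewrite dotDl dotZl (dotC _ b) dot_perp mulr0 add0r => /eqP.
    by rewrite dot_eq0 => /eqP.
  have mb : m = axial b m by rewrite -[LHS](axial_perp _ b) mperp addr0.
  have m1 : dot m b1 = 0 by rewrite -mE tripleE; ring.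
  have md : dot m d = 0 by rewrite -mE tripleE; ring.
  have [c0|c0] := eqVneq (dot m b / dot b b) 0.
    left; have m0 : m = 0 by rewrite mb /axial c0 scale0r.
    (* By Lagrange's identity the squared length of [m] is that of [b1] times that of
       [perp b1 d]. *)
    have lagrange : dot m m = dot b1 b1 * dot d d - dot d b1 * dot d b1.
      by rewrite -mE tripleE !mxE !tripleE !mxE !dotE /=; ring.
    have b1b1 : dot b1 b1 != 0 by rewrite dot_eq0.
    have : dot b1 b1 * dot (perp b1 d) (perp b1 d) = 0.
      transitivity (dot m m); last by rewrite m0 dot0l.
      by rewrite lagrange perpE !dotL (dotC _ b1 d); field; exact: b1b1.
    by move/eqP; rewrite mulf_eq0 (negPf b1b1) dot_eq0 => /eqP.
  right; move: m1 md; rewrite mb !dotZl => /eqP; rewrite mulf_eq0 (negPf c0) /=.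
  by move=> /eqP -> /eqP; rewrite mulf_eq0 (negPf c0) => /eqP.
- have -> : d = axial b1 d by rewrite -[LHS](axial_perp _ b1) d0 addr0.
  by rewrite tripleE !mxE; ring.
- by apply: (triple_orth _ _ _ _ _ b0) => //; rewrite dotC.
Qed.

Lemma lever_spoke x r :
  perp b1 (lever R n b1 x r) =
  2^-1 *: (spoke R n b1 x r.-1 + spoke R n b1 x r).
Proof.
rewrite /lever /spoke !(perpD, perpN).
move: (perp _ _) (perp _ (psum _ _ _ _ r)) (perp _ (psum _ _ _ _ n)) => u v w.
by apply: row3P; rewrite !mxE; field.
Qed.

(** A difference of squares: the two spokes differ by twice the projected edge, and their sum is
    twice the projected lever. *)
Lemma spoke_step x r : (2 <= r)%N ->
  dot (spoke R n b1 x r) (spoke R n b1 x r) =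
  dot (spoke R n b1 x r.-1) (spoke R n b1 x r.-1)
  + 4 * dot (perp b1 (bvec b1 x r)) (perp b1 (lever R n b1 x r)).
Proof.
move=> r2; rewrite lever_spoke (spoke_pred _ _ _ _ _ r2).
move: (spoke _ _ _ _ _) (perp _ _) => u v.
by rewrite !dotL (dotC _ v u); field.
Qed.

(** By [spoke_step] either alternative keeps the spoke length from one vertex to the next.
    Conversely, equal lengths make an edge orthogonal to [b1] also orthogonal to its lever. A
    vanishing projected lever is a diametral edge. *)
Lemma lever_diacyclic x : (2 <= n)%N ->
  (forall r, (2 <= r <= n)%N ->
     perp b1 (lever R n b1 x r) = 0 \/
     dot (bvec b1 x r) b1 = 0 /\ dot (bvec b1 x r) (lever R n b1 x r) = 0) <->
  diacyclic R n b1 x.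
Proof.
move=> n2.
have lever0 r : perp b1 (lever R n b1 x r) = 0 <-> diametral R n b1 x r.
  rewrite lever_spoke /diametral; split=> [/eqP|/eqP ->]; last exact: scaler0.
  by rewrite scaler_eq0 invr_eq0 pnatr_eq0.
have orth_lever r : dot (bvec b1 x r) b1 = 0 ->
    dot (bvec b1 x r) (lever R n b1 x r) =
    dot (perp b1 (bvec b1 x r)) (perp b1 (lever R n b1 x r)).
  move=> br; rewrite (perp_orth _ _ _ br).
  rewrite -{1}(axial_perp _ b1 (lever _ _ _ _ _)).
  by rewrite dotDr dotZr br mulr0 add0r.
split=> [H|[sph orth] r rn].
  split=> [|r rn]; last first.
    by case: (H r rn) => [/lever0|[]]; [right|left].
  have step r : (2 <= r <= n)%N ->
      dot (spoke R n b1 x r) (spoke R n b1 x r) =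
      dot (spoke R n b1 x r.-1) (spoke R n b1 x r.-1).
    move=> rn; rewrite spoke_step; last by case/andP: rn.
    case: (H r rn) => [->|[br]].
      by rewrite (dotC _ _ 0) dot0l mulr0 addr0.
    by rewrite orth_lever // => ->; rewrite mulr0 addr0.
  have base j : (1 <= j <= n)%N -> dot (spoke R n b1 x j) (spoke R n b1 x j) =
      dot (spoke R n b1 x 1) (spoke R n b1 x 1).
    case/andP; case: j => [//|j] _; elim: j => [|j IH] jn; first reflexivity.
    rewrite (step j.+2) ?jn // -IH ?(ltnW jn) //; reflexivity.
  move=> j jn; rewrite (base j jn) (base n) ?leqnn ?(ltnW n2) //; reflexivity.
have [r2 r_n] := andP rn.
case: (orth r rn) => [br|/lever0]; [right|by left].
split=> //; rewrite orth_lever //; have := spoke_step x r r2.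
have r1 : (1 <= r <= n)%N by rewrite ltnW.
have rp : (1 <= r.-1 <= n)%N.
  by rewrite (leq_trans (leq_pred r)) // andbT; case: (r) r2 => [|[]].
rewrite (sph r r1) (sph _ rp) => /esym/eqP.
by rewrite addrC -subr_eq0 addrK mulf_eq0 pnatr_eq0 => /eqP.
Qed.

End LeverConditions.

(** * Criticality as the diacyclic condition, and its normal form under mirror moves *)

Theorem theorem4p5 (R : realType) (n : nat) (l : nat -> R) (b1 : 'rV[R]_3)
    (x : 'M[R]_(n.-1, 3)) :
  (2 <= n)%N ->
  (forall r : nat, (1 <= r <= n)%N -> 0 < l r) ->
  enorm b1 = l 1%N ->
  arm_space b1 l x ->
  critical_point (arm_space b1 l) (signed_volume b1) x <->
  exists s : seq nat,
    (forall r : nat, r \in s -> (2 <= r <= n.-1)%N) /\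
    form_F b1 (mirror_seq b1 s x).
Proof.
move=> n2 l_gt0 b1l xM.
have nz (u : 'rV[R]_3) : 0 < enorm u -> u != 0.
  by apply: contraTneq => ->; rewrite /enorm dot0l sqrtr0 ltxx.
have b10 : b1 != 0 by apply: nz; rewrite b1l; apply: l_gt0; exact: ltnW.
have b0 r : (2 <= r <= n)%N -> bvec b1 x r != 0.
  by move=> rn; apply: nz; rewrite xM // l_gt0 //; case/andP: rn => /ltnW ->.
have critE : critical_point (arm_space b1 l) (signed_volume b1) x <->
    diacyclic R n b1 x.
  rewrite (critical_lever _ _ _ _ _ n2 xM b0) -(lever_diacyclic _ _ _ _ n2).
  split=> H r => [rn|v rn].
    by apply/(triple_tangent_eq0 _ _ _ _ b10 (b0 r rn)) => v; exact: H.
  by apply: (triple_tangent_eq0 _ _ _ _ b10 (b0 r rn)).2; exact: H.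
rewrite critE; split=> [|[s [sn sF]]].
  move=> /diametral_sorted[s [sn ds ss]]; exists s; split=> //.
  exact: sorted_form.
(* Form (F) makes the moved arm diacyclic, and the moves are undone one by one. *)
apply: (diacyclic_mirror_seq _ _ _ _ _ sn).
exact: form_diacyclic.
Qed.
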